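(* Consider the case without line thermal limits, as described in the context, and assume Assumptions 1 and 2 hold. Then along every trajectory of the DPPD dynamics (without line limits), $$\liminf_{t\to\infty}\big(\|\dot d\|+\|\dot\eta\|+\|\dot{\hat\theta}\|+\|\dot P\|+\|\dot\mu\|+\|\dot\omega\|\big)=O(1/\sqrt t),$$ i.e. $\liminf_{t\to\infty}\sqrt t\,\big(\|\dot d\|+\|\dot\eta\|+\|\dot{\hat\theta}\|+\|\dot P\|+\|\dot\mu\|+\|\dot\omega\|\big)<\infty$.
   Context: Power network: a directed connected graph $\mathcal G(\mathcal N,\mathcal E)$ with buses $\mathcal N=\{1,\dots,n\}$ and lines $\mathcal E\subseteq\mathcal N\times\mathcal N$. Each line $ij$ has susceptance $B_{ij}>0$; each bus has damping $D_i>0$ and a given constant power injection $P_i^{in}\in\mathbb R$. For $x\in\mathbb R^n$ write $x_{ij}=x_i-x_j$. $\|\cdot\|$ is the Euclidean norm. Costs: $f_i=f_{i,0}+f_{i,1}+f_{i,2}$, where $f_{i,0}:\mathbb R\to\mathbb R$ is differentiable, $f_{i,1}$ is the indicator function of $\Omega_i=[\underline d_i,\overline d_i]$, and $f_{i,2}:\mathbb R\to\mathbb R$ is lower semicontinuous convex; $\Omega=\Omega_1\times\dots\times\Omega_n$. Assumption 1: each $f_{i,0}$ is $\beta$-strongly convex with $\beta>1$. Assumption 2 (Slater): there exist $\tilde d\in\mathrm{relint}(\Omega)$ and $\tilde\theta\in\mathbb R^n$ with $0=P_i^{in}-\tilde d_i+\sum_{k:ki\in\mathcal E}B_{ki}\tilde\theta_{ki}-\sum_{j:ij\in\mathcal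 E}B_{ij}\tilde\theta_{ij}$ for all $i$ and $\underline P_{ij}<B_{ij}\tilde\theta_{ij}<\overline P_{ij}$ for all $ij\in\mathcal E$ (for given line limits $\underline P_{ij}\le\overline P_{ij}$). Proximal operator: $\mathbf{prox}_{g}(y)=\arg\min_x\{g(x)+\tfrac12\|x-y\|^2\}$. DPPD dynamics without line limits (fixed constant $\kappa\in(0,1)$): with $u_{i,1}=P_i^{in}-d_i-D_i\omega_i+\sum_{k:ki\in\mathcal E}P_{ki}-\sum_{j:ij\in\mathcal E}P_{ij}$ and $u_{i,2}=P_i^{in}-d_i+\sum_{k:ki\in\mathcal E}B_{ki}\hat\theta_{ki}-\sum_{j:ij\in\mathcal E}B_{ij}\hat\theta_{ij}$: $\dot\eta_i=\mathbf{prox}_{f_{i,2}}(d_i-\kappa\eta_i)-d_i$; $\dot d_i=\mathbf{prox}_{f_{i,1}}\big(d_i-\nabla f_{i,0}(d_i)+\kappa\eta_i+\lambda_i+u_{i,1}+\mu_i+u_{i,2}\big)-d_i$; $\omega_i=\lambda_i$; $\dot{\hat\theta}_i=\sum_{j:ij\in\mathcal E}B_{ij}(\mu_i+u_{i,2}-\mu_j-u_{j,2})-\sum_{k:ki\in\mathcal E}B_{ki}(\mu_k+u_{k,2}-\mu_i-u_{i,2})$; $\dot P_{ij}=\lambda_i+u_{i,1}-\lambda_j-u_{j,1}$; $\dot\lambda_i=\tfrac12u_{i,1}$; $\dot\mu_i=\tfrac12u_{i,2}$. Vectors $d,\eta,\hat\theta,\mu,\omega\in\mathbb R^n$, $P\in\mathbb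 R^{|\mathcal E|}$ stack the corresponding components. *)

(* Defs.v *)
From HB Require Import structures.
From mathcomp Require Import all_boot all_order all_algebra.
From mathcomp Require Import all_classical all_reals all_analysis.
Set Implicit Arguments. Unset Strict Implicit. Unset Printing Implicit Defensive.
Import Order.TTheory GRing.Theory Num.Theory.
Import numFieldNormedType.Exports.
Local Open Scope ring_scope.

Section Defs.
Variables (R : realType) (n : nat).
Notation edge := ('I_n * 'I_n)%type.

Definition vnorm (x : 'I_n -> R) : R := Num.sqrt (\sum_(i < n) x i ^+ 2).
Definition enorm (E : {set edge}) (x : edge -> R) : R :=
  Num.sqrt (\sum_(e in E) x e ^+ 2).

Definition graph_connected (E : {set edge}) : Prop :=
  forall i j : 'I_n,
    connect (fun a b : 'I_n => ((a, b) \in E) || ((b, a) \in E)) i j.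

Definition netflow (E : {set edge}) (F : edge -> R) (i : 'I_n) : R :=
  \sum_(e in E | e.2 == i) F e - \sum_(e in E | e.1 == i) F e.

Definition ediff (x : 'I_n -> R) (e : edge) : R := x e.1 - x e.2.

End Defs.

Definition convex_fun (R : realType) (f : R -> R) : Prop :=
  forall x y t, 0 <= t <= 1 ->
    f (t * x + (1 - t) * y) <= t * f x + (1 - t) * f y.

Definition strongly_convex (R : realType) (beta : R) (f : R -> R) : Prop :=
  forall x y t, 0 <= t <= 1 ->
    f (t * x + (1 - t) * y) <=
      t * f x + (1 - t) * f y - beta / 2 * t * (1 - t) * (x - y) ^+ 2.

(* x = prox_g(y) where g = h + indicator of A, i.e.
   x = argmin_{z in A} { h z + 1/2 (z - y)^2 }.  With A = setT this is prox_h,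
   with h = 0 it is the prox of the indicator function of A. *)
Definition is_prox_on (R : realType) (A : set R) (h : R -> R) (y x : R) : Prop :=
  A x /\ forall z, A z -> h x + (x - y) ^+ 2 / 2 <= h z + (z - y) ^+ 2 / 2.

Definition in_relint_interval (R : realType) (lo hi x : R) : Prop :=
  (lo < x < hi) \/ (lo = hi /\ x = lo).

(* Main.v *)
Require Import Defs.
From HB Require Import structures.
From mathcomp Require Import all_boot all_order all_algebra.
From mathcomp Require Import all_classical all_reals all_analysis.
From mathcomp Require Import lra ring.
Set Implicit Arguments. Unset Strict Implicit. Unset Printing Implicit Defensive.
Import Order.TTheory GRing.Theory Num.Theory.
Import numFieldNormedType.Exports.
Local Open Scope ring_scope.

(** The dynamics is compared with an equilibrium at which lambda = 0 and mu = c
    is constant, where c is the common marginal price of an economic dispatch problem.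
    Write ~ for deviations from it. The sum over the nodes of

      kappa/2 eta~^2 - kappa eta~ d~ + d~^2/2
      + (Bregman divergence of f_0 from the equilibrium value of d to d)
      + theta~^2/2 + mu~^2 + mu~ u_2 + u_2^2/2
      + lambda^2 + lambda u_1 + u_1^2/2 + 3/2 D lambda^2

    plus the sum of P~^2/2 over the lines is a nonnegative function W. Adding the
    variational inequalities of the two proximal steps and using strong monotonicity
    of f_0' gives W' <= - (1 - (1 + kappa)^2 / (4 beta)) * |velocity|^2; the cross term
    (1 + kappa) eta' d~ is absorbed because kappa < 1 < beta. Hence |velocity|^2 cannot
    stay above 1/t, as W would then drop below every bound like - ln t. *)

(** * First-order conditions for convex functions of one variable *)

(** Divide by [t] and let [t] decrease to 0. The slack [t ^+ 2 * L] leaves room for the quadratic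
    gap of strong convexity. *)
Lemma derive1_mul_le (R : realType) (f : R -> R) (x v K L : R) :
  derivable f x 1 ->
  (forall t, 0 < t <= 1 -> f (x + t * v) - f x <= t * K + t ^+ 2 * L) ->
  derive1 f x * v <= K.
Proof.
move=> df H.
have dl : is_derive (0 : R) 1 (fun t : R => x + t * v) v.
  by apply: is_derive_eq; rewrite /GRing.scale/=; ring.
have dg : is_derive (0 : R) 1 (fun t => f (x + t * v)) (derive1 f x * v).
  apply: (@is_derive1_comp _ f (fun t : R => x + t * v)) => //.
  by rewrite mul0r addr0 derive1E; apply/derivableP.
have := @ex_derive _ _ _ _ _ _ _ dg; rewrite /derivable => cg.
have eg := @derive_val _ _ _ _ _ _ _ dg.
have cgr : ((h^-1 *: (f (x + (h *: 1 + 0) * v) - f (x + 0 * v))) @[h --> 0^'+] -->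
    derive1 f x * v)%classic.
  apply: cvg_dnbhs_at_right; rewrite -eg; exact: cg.
rewrite mul0r addr0 in cgr.
have cK : ((K + h * L) @[h --> (0:R)^'+] --> K)%classic.
  have : ((K + h * L) @[h --> (0:R)^'+] --> K + 0 * L)%classic.
    apply: cvgD; first exact: cvg_cst.
    apply: cvgMl; apply: cvg_at_right_filter; exact: cvg_id.
  by rewrite mul0r addr0.
apply: (ler_cvg_to cgr cK).
near=> h.
have h0 : 0 < h by near: h; exact: nbhs_right_gt.
have h1 : h <= 1 by near: h; exact: nbhs_right_le.
have := H h; rewrite h0 h1 => /(_ isT) Hh.
rewrite /GRing.scale/= mulr1 addr0 mulrC ler_pdivrMr//.
by apply: le_trans Hh _; rewrite le_eqVlt; apply/orP; left; apply/eqP; ring.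
Unshelve. all: by end_near.
Qed.

Lemma strongly_convexD (R : realType) (beta : R) (f g : R -> R) :
  strongly_convex beta f -> convex_fun g ->
  strongly_convex beta (fun x => f x + g x).
Proof. by move=> cf cg x y t ht; have := cf x y t ht; have := cg x y t ht; lra. Qed.

Lemma strongly_convex_convex (R : realType) (beta : R) (f : R -> R) :
  0 <= beta -> strongly_convex beta f -> convex_fun f.
Proof.
move=> b0 cf x y t /[dup] ht /andP[t0 t1]; have := cf x y t ht.
have : 0 <= beta / 2 * t * (1 - t) * (x - y) ^+ 2.
  apply: mulr_ge0; last exact: sqr_ge0.
  by apply: mulr_ge0; [apply: mulr_ge0 => //; lra | lra].
lra.
Qed.

(** The gap [t * (1 - t)] on the segment from [x] to [z] splits into a linear part, kept in [K], and
    a quadratic part, put in [L]. *)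
Lemma strongly_convex_tangent (R : realType) (beta : R) (f : R -> R) (x z : R) :
  derivable f x 1 -> strongly_convex beta f ->
  f x + derive1 f x * (z - x) + beta / 2 * (z - x) ^+ 2 <= f z.
Proof.
move=> df cf.
suff : derive1 f x * (z - x) <= f z - f x - beta / 2 * (z - x) ^+ 2 by lra.
apply: (@derive1_mul_le _ _ _ _ _ (beta / 2 * (z - x) ^+ 2)) => // t /andP[t0 t1].
have := cf z x t; rewrite (ltW t0) t1 => /(_ isT).
have -> : t * z + (1 - t) * x = x + t * (z - x) by ring.
have -> : beta / 2 * t * (1 - t) * (z - x) ^+ 2 =
  t * (beta / 2 * (z - x) ^+ 2) - t ^+ 2 * (beta / 2 * (z - x) ^+ 2) by ring.
lra.
Qed.

Lemma strongly_monotone_derive1 (R : realType) (beta : R) (f : R -> R) (x y : R) :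
  (forall z, derivable f z 1) -> strongly_convex beta f ->
  beta * (x - y) ^+ 2 <= (derive1 f x - derive1 f y) * (x - y).
Proof.
move=> df cf.
have := strongly_convex_tangent y (df x) cf.
have := strongly_convex_tangent x (df y) cf.
nra.
Qed.

Lemma convex_chord (R : realType) (f : R -> R) (x y z : R) :
  convex_fun f -> x < y -> y < z ->
  (z - x) * f y <= (z - y) * f x + (y - x) * f z.
Proof.
move=> cf xy yz; have zx : 0 < z - x by lra.
have := cf x z ((z - y) / (z - x)).
have -> : (z - y) / (z - x) * x + (1 - (z - y) / (z - x)) * z = y.
  by field; lra.
rewrite ler_pdivlMr// ler_pdivrMr// => H.
have : 0 * (z - x) <= z - y <= 1 * (z - x) by lra.
move/H; rewrite -(ler_pM2l zx) => /le_trans; apply.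
by rewrite le_eqVlt; apply/orP; left; apply/eqP; field; lra.
Qed.

(** Only [f] is differentiated; convexity bounds the increment of [h] along the segment by
    [t * (h z - h x)]. *)
Lemma argmin_linearized (R : realType) (A : set R) (f h : R -> R) (x z : R) :
  derivable f x 1 -> convex_fun h ->
  (forall t, 0 < t <= 1 -> A (x + t * (z - x))) ->
  (forall w, A w -> f x + h x <= f w + h w) ->
  0 <= derive1 f x * (z - x) + (h z - h x).
Proof.
move=> df ch Az m.
have dN : derivable (- f) x 1 by apply: derivableN.
suff : derive1 (- f) x * (z - x) <= h z - h x.
  by rewrite derive1N//; lra.
apply: (@derive1_mul_le _ _ _ _ _ 0) => // t /andP[t0 t1].
have := m _ (Az t _); rewrite t0 t1 => /(_ isT).
have := ch z x t; rewrite (ltW t0) t1 => /(_ isT).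
have -> : t * z + (1 - t) * x = x + t * (z - x) by ring.
have Nf w : (- f) w = - f w by [].
rewrite !Nf; lra.
Qed.

(** With the quadratic term as smooth part, minimality makes [y - x] a subgradient of [h] at [x]
    relative to [A]. This is the variational inequality of a proximal step. *)
Lemma is_prox_on_subgradient (R : realType) (A : set R) (h : R -> R) (y x z : R) :
  convex_fun h -> is_prox_on A h y x ->
  (forall t, 0 < t <= 1 -> A (x + t * (z - x))) ->
  (y - x) * (z - x) <= h z - h x.
Proof.
move=> ch [Ax m] Az.
have dq : is_derive x 1 (fun w : R => (w - y) ^+ 2 / 2) (x - y).
  apply: is_derive_eq; rewrite /GRing.scale/=; lra.
have [dq1 dq2] := dq.
have := @argmin_linearized _ A (fun w : R => (w - y) ^+ 2 / 2) h x z dq1 ch Az.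
rewrite derive1E dq2.
have m' w : A w -> (x - y) ^+ 2 / 2 + h x <= (w - y) ^+ 2 / 2 + h w.
  by move=> /m; lra.
by move=> /(_ m'); nra.
Qed.

Lemma convex_fun_cst0 (R : realType) : convex_fun (fun _ : R => 0 : R).
Proof. by move=> x y t _; rewrite !mulr0 addr0. Qed.

Lemma is_prox_on_itv_normal (R : realType) (lo hi y x z : R) :
  is_prox_on `[lo, hi]%classic (fun _ => 0) y x -> lo <= z <= hi ->
  (y - x) * (z - x) <= 0.
Proof.
move=> px /andP[z1 z2]; rewrite -[leRHS](subrr 0).
apply: (is_prox_on_subgradient (@convex_fun_cst0 R) px) => t /andP[t0 t1].
case: px => + _; rewrite /= !in_itv/= => /andP[x1 x2]; apply/andP; split; nra.
Qed.

(** * Continuity and subgradients of convex functions on the line *)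

Lemma locally_lipschitz_continuous (R : realType) (f : R -> R) (x L : R) :
  0 < L -> (forall y, `|x - y| < 1 -> `|f x - f y| <= L * `|x - y|) ->
  {for x, continuous f}.
Proof.
move=> L0 bnd; apply/cvgrPdist_le => e e0.
near=> y.
have y1 : `|x - y| < 1 by near: y; exact: (@cvgr_dist_lt _ _ _ _ _ id).
have y2 : `|x - y| < e / L by near: y; apply: (@cvgr_dist_lt _ _ _ _ _ id) => //; rewrite divr_gt0.
apply: le_trans (bnd _ y1) _.
by rewrite mulrC -ler_pdivlMr// ltW.
Unshelve. all: by end_near.
Qed.

Lemma convex_fun_continuous (R : realType) (f : R -> R) :
  convex_fun f -> continuous f.
Proof.
move=> cf; suff H (x : R) : {for x, continuous f} by move=> x; exact: H.
(* Slopes of chords from [x] to points at distance below 1 lie between those to [x - 1] and [x + 1];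
   the final 1 makes [L] positive. *)
pose L : R := `|f (x + 1) - f x| + `|f x - f (x - 1)| + 1.
have L0 : 0 < L by rewrite /L ltr_wpDl ?addr_ge0.
have bnd y : `|x - y| < 1 -> `|f x - f y| <= L * `|x - y|.
  move=> xy1.
  have H1 := ler_norm (f (x + 1) - f x).
  have H2 := ler_norm (f x - f (x - 1)).
  have H3 := lerNnormlW (lexx `|f (x + 1) - f x|).
  have H4 := lerNnormlW (lexx `|f x - f (x - 1)|).
  have H5 : `|f (x + 1) - f x| + `|f x - f (x - 1)| <= L by rewrite /L; lra.
  have H6 := normr_ge0 (f (x + 1) - f x).
  have H7 := normr_ge0 (f x - f (x - 1)).
  move: H1 H2 H3 H4 H5 H6 H7 xy1.
  move: `|f (x + 1) - f x| `|f x - f (x - 1)| => a b H1 H2 H3 H4 H5 H6 H7.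
  case: (ltgtP y x) => [yx|xy|->]; last by rewrite !subrr normr0 mulr0.
  - rewrite (gtr0_norm (_ : 0 < x - y)) ?subr_gt0// => xy1.
    have C1 : (x - (x - 1)) * f y <= (x - y) * f (x - 1) + (y - (x - 1)) * f x.
      by apply: convex_chord => //; lra.
    have C2 : (x + 1 - y) * f x <= (x + 1 - x) * f y + (x - y) * f (x + 1).
      by apply: convex_chord => //; lra.
    have E1 : 0 <= (x - y) * (L - a - b) by rewrite mulr_ge0//; lra.
    have E2 : 0 <= (x - y) * (a - (f (x + 1) - f x)) by rewrite mulr_ge0//; lra.
    have E3 : 0 <= (x - y) * (b + (f x - f (x - 1))) by rewrite mulr_ge0//; lra.
    have E4 : 0 <= (x - y) * a by rewrite mulr_ge0//; lra.
    have E5 : 0 <= (x - y) * b by rewrite mulr_ge0//; lra.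
    by rewrite ler_norml; apply/andP; split; lra.
  - rewrite (ltr0_norm (_ : x - y < 0)) ?subr_lt0// => xy1.
    have C1 : (x + 1 - x) * f y <= (x + 1 - y) * f x + (y - x) * f (x + 1).
      by apply: convex_chord => //; lra.
    have C2 : (y - (x - 1)) * f x <= (y - x) * f (x - 1) + (x - (x - 1)) * f y.
      by apply: convex_chord => //; lra.
    have E1 : 0 <= (y - x) * (L - a - b) by rewrite mulr_ge0//; lra.
    have E2 : 0 <= (y - x) * (a - (f (x + 1) - f x)) by rewrite mulr_ge0//; lra.
    have E3 : 0 <= (y - x) * (b + (f x - f (x - 1))) by rewrite mulr_ge0//; lra.
    have E4 : 0 <= (y - x) * a by rewrite mulr_ge0//; lra.
    have E5 : 0 <= (y - x) * b by rewrite mulr_ge0//; lra.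
    by rewrite ler_norml; apply/andP; split; lra.
exact: locally_lipschitz_continuous bnd.
Qed.

(** Sum rule for [f] plus the indicator of [[lo, hi]]: a subgradient [a] relative to the interval
    splits into a global subgradient [s] and an element [a - s] of the normal cone at [d]. The
    former feeds the [eta] equation, the latter the [d] equation. *)
Lemma convex_subgradient_itv (R : realType) (f : R -> R) (lo hi d a : R) :
  convex_fun f -> lo <= d <= hi ->
  (forall z, lo <= z <= hi -> a * (z - d) <= f z - f d) ->
  exists s, (forall z, s * (z - d) <= f z - f d) /\
            (forall z, lo <= z <= hi -> 0 <= (s - a) * (z - d)).
Proof.
move=> cf /andP[lod dhi] amin.
(* Slopes of chords starting at [d] are nondecreasing, so the inequality at [hi] extends beyond
   [hi]; [aL] is the mirror image. *)
have aR z : d < hi -> d < z -> a * (z - d) <= f z - f d.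
  move=> dh dz; case: (leP z hi) => zh; first by apply: amin; lra.
  have C := convex_chord cf dh zh.
  have A : a * (hi - d) <= f hi - f d by apply: amin; lra.
  have h0 : 0 < hi - d by lra.
  by rewrite -(ler_pM2l h0); nra.
have aL z : lo < d -> z < d -> a * (z - d) <= f z - f d.
  move=> ld zd; case: (leP lo z) => zh; first by apply: amin; lra.
  have C := convex_chord cf zh ld.
  have A : a * (lo - d) <= f lo - f d by apply: amin; lra.
  have h0 : 0 < d - lo by lra.
  by rewrite -(ler_pM2l h0); nra.
(* The supremum of the left slopes at [d], together with [a] when [d < hi]:
   every right slope is an upper bound, and so is [a] when [lo < d]. *)
pose S := [set u : R | (exists2 z, z < d & u * (d - z) = f d - f z) \/
                       (d < hi /\ u = a)]%classic.
have S0 : (S !=set0)%classic.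
  exists (f d - f (d - 1)); left; exists (d - 1); first by lra.
  by ring.
have ubR z : d < z -> ubound S ((f z - f d) / (z - d)).
  move=> dz u; have z0 : 0 < z - d by lra.
  rewrite ler_pdivlMr// => -[[w wd uE]|[dh ->]]; last exact: aR.
  have C := convex_chord cf wd dz.
  have w0 : 0 < d - w by lra.
  rewrite -(ler_pM2l w0) mulrA [_ * u]mulrC uE; nra.
have hub : has_ubound S by eexists; apply: (ubR (d + 1)); lra.
exists (sup S); split=> [z|z /andP[z1 z2]].
- case: (ltgtP z d) => [zd|dz|->]; last by rewrite !subrr mulr0.
  + have : S ((f d - f z) / (d - z)).
      by left; exists z => //; field; lra.
    move=> /(ub_le_sup hub); rewrite ler_pdivrMr; [lra|].
    by lra.
  + have := ge_sup S0 (ubR _ dz).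
    by rewrite ler_pdivlMr// subr_gt0.
- case: (ltgtP z d) => [zd|dz|->]; last by rewrite !subrr mulr0.
  + have : sup S <= a.
      apply: ge_sup => // u [[w wd uE]|[_ ->]//].
      have aw := aL w (le_lt_trans z1 zd) wd.
      have w0 : 0 < d - w by lra.
      by rewrite -(ler_pM2r w0) uE; nra.
    by nra.
  + have : a <= sup S by apply: (ub_le_sup hub); right; split=> //; lra.
    by nra.
Qed.

(** * Minimisers under a linear price and economic dispatch *)

(** As [f] need not be differentiable, the derivative bound is applied to the tilt [c * w], whose
    increments minimality bounds by those of [f]. *)
Lemma strongly_convex_growth (R : realType) (beta : R) (f : R -> R)
    (lo hi c x z : R) :
  strongly_convex beta f -> lo <= x <= hi ->
  (forall w, lo <= w <= hi -> f x - c * x <= f w - c * w) ->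
  lo <= z <= hi ->
  f x - c * x + beta / 2 * (z - x) ^+ 2 <= f z - c * z.
Proof.
move=> cf /andP[x1 x2] m /andP[z1 z2].
have dl : is_derive x 1 (fun w : R => c * w) c.
  by apply: is_derive_eq; rewrite /GRing.scale/=; ring.
have [dl1 dl2] := dl.
suff : derive1 (fun w : R => c * w) x * (z - x) <=
    f z - f x - beta / 2 * (z - x) ^+ 2 by rewrite derive1E dl2; lra.
apply: (@derive1_mul_le _ _ _ _ _ (beta / 2 * (z - x) ^+ 2)) => // t /andP[t0 t1].
have : f x - c * x <= f (x + t * (z - x)) - c * (x + t * (z - x)).
  by apply: m; apply/andP; split; nra.
have := cf z x t; rewrite (ltW t0) t1 => /(_ isT).
have -> : t * z + (1 - t) * x = x + t * (z - x) by ring.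
have -> : beta / 2 * t * (1 - t) * (z - x) ^+ 2 =
  t * (beta / 2 * (z - x) ^+ 2) - t ^+ 2 * (beta / 2 * (z - x) ^+ 2) by ring.
lra.
Qed.

(** Adding the growth inequalities of the two minimisers gives [beta * (x - x') ^+ 2 <= (c - c') *
    (x - x')]. *)
Lemma argmin_tilted_lipschitz (R : realType) (beta : R) (f : R -> R)
    (lo hi c c' x x' : R) :
  0 < beta -> strongly_convex beta f ->
  lo <= x <= hi -> lo <= x' <= hi ->
  (forall w, lo <= w <= hi -> f x - c * x <= f w - c * w) ->
  (forall w, lo <= w <= hi -> f x' - c' * x' <= f w - c' * w) ->
  `|x - x'| <= beta^-1 * `|c - c'|.
Proof.
move=> b0 cf hx hx' m m'.
have H1 := strongly_convex_growth cf hx m hx'.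
have H2 := strongly_convex_growth cf hx' m' hx.
rewrite mulrC ler_pdivlMr//.
have H : `|x - x'| * beta * `|x - x'| <= `|c - c'| * `|x - x'|.
  rewrite mulrAC -expr2 real_normK ?num_real// -normrM.
  by apply: le_trans (ler_norm _); nra.
case: (eqVneq x x') => [->|xx']; first by rewrite subrr normr0 mul0r.
by move: H; rewrite ler_pM2r// normr_gt0 subr_eq0.
Qed.

(** By convexity, slopes to the left of [hi] are at most that of the chord over [[hi, hi + 1]]. A
    price above it makes the tilted function decrease up to [hi]. *)
Lemma argmin_tilted_hi (R : realType) (f : R -> R) (lo hi c x : R) :
  convex_fun f -> lo <= x <= hi -> f (hi + 1) - f hi < c ->
  (forall w, lo <= w <= hi -> f x - c * x <= f w - c * w) -> x = hi.
Proof.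
move=> cf /andP[x1 x2] hc m; apply/eqP; move: x2; rewrite le_eqVlt => /orP[//|xh].
exfalso.
have C : (hi + 1 - x) * f hi <= (hi + 1 - hi) * f x + (hi - x) * f (hi + 1).
  by apply: convex_chord => //; lra.
have : f x - c * x <= f hi - c * hi by apply: m; lra.
by nra.
Qed.

Lemma argmin_tilted_lo (R : realType) (f : R -> R) (lo hi c x : R) :
  convex_fun f -> lo <= x <= hi -> c < f lo - f (lo - 1) ->
  (forall w, lo <= w <= hi -> f x - c * x <= f w - c * w) -> x = lo.
Proof.
move=> cf /andP[x1 x2] hc m; apply/eqP; move: x1; rewrite eq_sym le_eqVlt => /orP[//|xh].
exfalso.
have C : (x - (lo - 1)) * f lo <= (x - lo) * f (lo - 1) + (lo - (lo - 1)) * f x.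
  by apply: convex_chord => //; lra.
have : f x - c * x <= f lo - c * lo by apply: m; lra.
by nra.
Qed.

(* The common marginal price [c] is found by the intermediate value theorem: the
   minimiser of [f i - c * id] is Lipschitz in [c] and saturates at both ends. *)
Lemma economic_dispatch (R : realType) (n : nat) (beta s : R)
    (f : 'I_n -> R -> R) (lo hi : 'I_n -> R) :
  0 < beta -> (forall i, strongly_convex beta (f i)) ->
  (forall i, lo i <= hi i) -> \sum_i lo i <= s <= \sum_i hi i ->
  exists (c : R) (d : 'I_n -> R),
    [/\ forall i, lo i <= d i <= hi i,
        forall i z, lo i <= z <= hi i -> f i (d i) - c * d i <= f i z - c * z
      & \sum_i d i = s].
Proof.
move=> b0 sc lohi /andP[slo shi].
have cf i : convex_fun (f i) by apply: strongly_convex_convex (sc i); exact: ltW.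
have ex (p : R * 'I_n) : exists x, lo p.2 <= x <= hi p.2 /\
    forall z, lo p.2 <= z <= hi p.2 -> f p.2 x - p.1 * x <= f p.2 z - p.1 * z.
  case: p => c i /=.
  have cts : {within `[lo i, hi i], continuous (fun x => f i x - c * x)}%classic.
    apply: continuous_subspaceT => x.
    apply: cvgB; first exact: convex_fun_continuous.
    by apply: cvgMr; exact: cvg_id.
  have [x xi m] := EVT_min (lohi i) cts.
  by exists x; split=> [|z zi]; [rewrite in_itv/= in xi|apply: m; rewrite in_itv].
have [D HD] := choice ex.
pose S c := \sum_i D (c, i).
have ctsS : continuous S.
  (* The [n] Lipschitz constants add up; the 1 keeps the total positive when [n = 0]. *)
  move=> c; apply: (@locally_lipschitz_continuous _ _ _ (n%:R * beta^-1 + 1)).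
    by rewrite ltr_wpDl// mulr_ge0 ?ler0n// invr_ge0 ltW.
  move=> c' _; rewrite /S -sumrB.
  apply: le_trans (ler_norm_sum _ _ _) _.
  apply: (@le_trans _ _ (\sum_(i < n) beta^-1 * `|c - c'|)).
    apply: ler_sum => i _.
    have [h1 m1] := HD (c, i); have [h2 m2] := HD (c', i).
    exact: (argmin_tilted_lipschitz b0 (sc i) h1 h2 m1 m2).
  rewrite sumr_const card_ord -[leLHS]mulr_natl mulrA.
  by rewrite ler_wpM2r// lerDl.
(* [M] exceeds the outer end slopes of every node, so the prices [M] and [- M] push all minimisers
   to the upper and lower ends. *)
pose M := 1 + \sum_i (`|f i (hi i + 1) - f i (hi i)| + `|f i (lo i) - f i (lo i - 1)|).
have Mi i : `|f i (hi i + 1) - f i (hi i)| + `|f i (lo i) - f i (lo i - 1)| < M.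
  rewrite /M (bigD1 i)//= [ltRHS]addrCA ltrDl ltr_pwDl//.
  by apply: sumr_ge0 => j _; exact: addr_ge0.
have M0 : 0 <= M by apply: addr_ge0 => //; apply: sumr_ge0 => j _; exact: addr_ge0.
have SM : S M = \sum_i hi i.
  apply: eq_bigr => i _; have [h m] := HD (M, i).
  apply: argmin_tilted_hi h _ m => //=.
  apply: le_lt_trans (Mi i); apply: le_trans (ler_norm _) _.
  by rewrite lerDl.
have SNM : S (- M) = \sum_i lo i.
  apply: eq_bigr => i _; have [h m] := HD (- M, i).
  apply: argmin_tilted_lo h _ m => //=.
  rewrite ltrNl; apply: le_lt_trans (Mi i); apply: le_trans (ler_norm _) _.
  by rewrite normrN lerDr.
have [|||c _ cE] := @IVT _ S (- M) M s.
- by lra.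
- exact: continuous_subspaceT.
- by rewrite SM SNM ge_min slo le_max shi orbT.
exists c, (fun i => D (c, i)); split => //.
- by move=> i; have [] := HD (c, i).
- by move=> i; have [_] := HD (c, i).
Qed.

(** * Network flows and the graph Laplacian *)

Section NetworkFlow.
Variables (R : realType) (n : nat) (E : {set 'I_n * 'I_n}).
Implicit Types (F : 'I_n * 'I_n -> R) (x : 'I_n -> R).

Lemma sum_edge_endpoint (h : 'I_n * 'I_n -> 'I_n) F x :
  \sum_i x i * (\sum_(e in E | h e == i) F e) = \sum_(e in E) x (h e) * F e.
Proof.
under eq_bigr do rewrite mulr_sumr.
rewrite (exchange_big_dep (mem E)) /=; last by move=> i e _ /andP[].
apply: eq_bigr => e eE.
rewrite (bigD1 (h e)) ?eE ?eqxx//= big1 ?addr0// => i /andP[/eqP->].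
by rewrite eqxx.
Qed.

(** Summation by parts: up to sign, [netflow] is the adjoint of [ediff]. *)
Lemma sum_mul_netflow F x :
  \sum_i x i * netflow E F i = - \sum_(e in E) F e * ediff x e.
Proof.
under eq_bigr do rewrite mulrBr.
rewrite sumrB !sum_edge_endpoint -sumrB -sumrN.
by apply: eq_bigr => e _; rewrite /ediff; ring.
Qed.

Lemma netflowB F G i : netflow E (fun e => F e - G e) i = netflow E F i - netflow E G i.
Proof. by rewrite /netflow !sumrB; ring. Qed.

Lemma eq_netflow F G i : {in E, F =1 G} -> netflow E F i = netflow E G i.
Proof.
move=> FG; rewrite /netflow.
by congr (_ - _); apply: eq_bigr => e /andP[eE _]; exact: FG.
Qed.

Lemma sum_netflow F : \sum_i netflow E F i = 0.
Proof.
have := sum_mul_netflow F (fun _ => 1).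
under eq_bigr do rewrite mul1r.
move=> ->; rewrite big1 ?oppr0// => e _.
by rewrite /ediff subrr mulr0.
Qed.

Variable B : 'I_n * 'I_n -> R.

(* [- laplacian] is the weighted graph Laplacian. *)
Definition laplacian x := netflow E (fun e => B e * ediff x e).

Lemma laplacianB x y i : laplacian (fun j => x j - y j) i = laplacian x i - laplacian y i.
Proof.
rewrite /laplacian -netflowB; apply: eq_netflow => e _.
by rewrite /ediff; ring.
Qed.

Lemma laplacian_sym x y : \sum_i x i * laplacian y i = \sum_i y i * laplacian x i.
Proof.
rewrite !sum_mul_netflow; congr (- _).
by apply: eq_bigr => e _; ring.
Qed.

(** This is the shape in which the [thh] equation of the dynamics is written. *)
Lemma laplacianE x i : laplacian x i =
  \sum_(e in E | e.2 == i) B e * (x e.1 - x i) -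
  \sum_(e in E | e.1 == i) B e * (x i - x e.2).
Proof.
rewrite /laplacian /netflow /ediff.
by congr (_ - _); apply: eq_bigr => e /andP[_ /eqP<-].
Qed.

Hypothesis HG : graph_connected E.
Hypothesis HB : forall e, e \in E -> 0 < B e.

(** The Dirichlet form of [x] vanishes, so [x] agrees across each line because [B] is positive
    there, and connectivity propagates this along a path. *)
Lemma laplacian_kernel x i j : (forall k, laplacian x k = 0) -> x i = x j.
Proof.
move=> x0.
have S0 : \sum_(e in E) B e * ediff x e ^+ 2 = 0.
  have := sum_mul_netflow (fun e => B e * ediff x e) x.
  rewrite big1 => [/esym/eqP|k _]; last by rewrite -/(laplacian x k) x0 mulr0.
  rewrite oppr_eq0 => /eqP S; rewrite -[RHS]S; apply: eq_bigr => e _; ring.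
have eq_edge e : e \in E -> x e.1 = x e.2.
  move=> eE; apply/eqP; rewrite -subr_eq0 -sqrf_eq0.
  move/psumr_eq0P : S0 => /(_ _ e eE)/eqP.
  rewrite mulf_eq0 gt_eqF ?HB//=; apply=> k kE.
  by rewrite mulr_ge0 ?sqr_ge0// ltW ?HB.
have /connectP[p pth ->] := HG i j.
elim: p i pth => //= k p IH i /andP[ik /IH <-].
by case/orP: ik => /eq_edge.
Qed.

(** Fredholm alternative: the matrix is symmetric, so its row space is the annihilator of its
    kernel, which consists of constant vectors. *)
Lemma laplacian_surj (y : 'I_n -> R) :
  \sum_i y i = 0 -> exists x, forall i, laplacian x i = y i.
Proof.
move=> y0.
pose L := (\matrix_(i, j) laplacian (fun k => (k == i)%:R) j : 'M[R]_n).
have LE (v : 'rV[R]_n) j : (v *m L) 0 j = laplacian (v 0) j.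
  rewrite mxE.
  under eq_bigr do rewrite mxE.
  have -> : laplacian (v 0) j = \sum_k (k == j)%:R * laplacian (v 0) k.
    rewrite (bigD1 j)//= eqxx mul1r big1 ?addr0// => k /negPf->.
    by rewrite mul0r.
  rewrite laplacian_sym; apply: eq_bigr => k _; congr (_ * _).
  have -> : laplacian (fun k0 => (k0 == k)%:R) j =
      \sum_i (i == j)%:R * laplacian (fun k0 => (k0 == k)%:R) i.
    rewrite (bigD1 j)//= eqxx mul1r big1 ?addr0// => i /negPf->.
    by rewrite mul0r.
  rewrite laplacian_sym (bigD1 k)//= eqxx mul1r big1 ?addr0// => i /negPf->.
  by rewrite mul0r.
have symL : L^T = L.
  apply/matrixP => i j; rewrite !mxE.
  have := laplacian_sym (fun k => (k == i)%:R) (fun k => (k == j)%:R).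
  rewrite (bigD1 i)//= eqxx mul1r big1 ?addr0; last by move=> k /negPf->; rewrite mul0r.
  rewrite (bigD1 j)//= eqxx mul1r big1 ?addr0; last by move=> k /negPf->; rewrite mul0r.
  by [].
have : ((\row_i y i) <= L)%MS.
  rewrite submxE; apply/eqP/matrixP => a j; rewrite !mxE.
  (* By symmetry of [L], the columns of its cokernel matrix lie in the kernel of the Laplacian. *)
  have ker k : laplacian (fun i => cokermx L i j) k = 0.
    have := LE (col j (cokermx L))^T k.
    have -> : (col j (cokermx L))^T *m L = (col j (L *m cokermx L))^T.
      by rewrite !colE -mulmxA [in RHS]trmx_mul symL.
    rewrite mulmx_coker !mxE => /esym <-.
    by congr (laplacian _ k); apply/funext => i; rewrite !mxE.
  (* A node [i0] is needed to name the constant value of the column; without nodes the sum is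
     empty. *)
  case: (pickP (fun _ : 'I_n => true)) => [i0 _|n0].
    under eq_bigr do
      rewrite mxE (laplacian_kernel _ i0 ker).
    by rewrite -mulr_suml y0 mul0r.
  by rewrite big1// => i; have := n0 i.
case/submxP => v vE; exists (v 0) => i.
by rewrite -LE -vE mxE.
Qed.

End NetworkFlow.

(** * Existence of an equilibrium *)

(** Dispatching the cost [f0 + f2] gives [c] and [ds]; the sum rule at each node gives [es], and
    solving a Laplacian equation gives [ths]. The conclusions are the stationarity conditions of the
    [eta], [d] and [mu] equations with [mu = c] and [lam = 0]. *)
Lemma equilibrium_exists (R : realType) (n : nat) (E : {set 'I_n * 'I_n})
    (B : 'I_n * 'I_n -> R) (Pin : 'I_n -> R) (f0 f2 : 'I_n -> R -> R)
    (lo hi dt th : 'I_n -> R) (beta kappa : R) :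
  graph_connected E -> (forall e, e \in E -> 0 < B e) ->
  (forall i x, derivable (f0 i) x 1) -> (forall i, convex_fun (f2 i)) ->
  0 < beta -> (forall i, strongly_convex beta (f0 i)) -> kappa != 0 ->
  (forall i, lo i <= dt i <= hi i) ->
  (forall i, 0 = Pin i - dt i + laplacian E B th i) ->
  exists (c : R) (ds es ths : 'I_n -> R),
    [/\ forall i, lo i <= ds i <= hi i,
        forall i z, - kappa * es i * (z - ds i) <= f2 i z - f2 i (ds i),
        forall i z, lo i <= z <= hi i ->
          (c + kappa * es i - derive1 (f0 i) (ds i)) * (z - ds i) <= 0
      & forall i, Pin i - ds i + laplacian E B ths i = 0].
Proof.
move=> HG HB df cf2 b0 sc k0 hdt hth.
have sc2 i : strongly_convex beta (fun x => f0 i x + f2 i x).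
  exact: strongly_convexD.
have [||c [ds [dsi dsm dss]]] :=
    economic_dispatch (s := \sum_i dt i) (lo := lo) (hi := hi) b0 sc2.
- by move=> i; have /andP[] := hdt i; exact: le_trans.
- by apply/andP; split; apply: ler_sum => i _; have /andP[] := hdt i.
(* Optimality of [ds i] makes [c - derive1 (f0 i) (ds i)] a subgradient of [f2 i] relative to the
   interval, which is then split. *)
have ex i : exists s, (forall z, s * (z - ds i) <= f2 i z - f2 i (ds i)) /\
    (forall z, lo i <= z <= hi i -> 0 <= (s - (c - derive1 (f0 i) (ds i))) * (z - ds i)).
  apply: convex_subgradient_itv => // z /andP[z1 z2].
  have /andP[d1 d2] := dsi i.
  have dg : is_derive (ds i) 1 (fun w : R => f0 i w - c * w) (derive1 (f0 i) (ds i) - c).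
    have d0 : is_derive (ds i) 1 (f0 i) (derive1 (f0 i) (ds i)).
      by rewrite derive1E; apply/derivableP.
    by apply: is_derive_eq; rewrite /GRing.scale/=; ring.
  have [dg1 dg2] := dg.
  have := @argmin_linearized _ [set w | lo i <= w <= hi i]%classic
    (fun w => f0 i w - c * w) (f2 i) (ds i) z dg1 (cf2 i).
  rewrite derive1E dg2 => H.
  suff : 0 <= (derive1 (f0 i) (ds i) - c) * (z - ds i) + (f2 i z - f2 i (ds i)).
    by lra.
  apply: H => [t /andP[t0 t1]|w /= wi].
    by rewrite /=; apply/andP; split; nra.
  by have := dsm i w wi; lra.
have [s Hs] := choice ex.
have [|ths Hths] := laplacian_surj HG HB (y := fun i => ds i - Pin i).
  (* Net flows sum to zero, so the feasible [dt], hence also [ds], has the same total as [Pin]. *)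
  rewrite sumrB dss -sumrB -[RHS](sum_netflow E (fun e => B e * ediff th e)).
  by apply: eq_bigr => i _; have := hth i; rewrite /laplacian; lra.
exists c, ds, (fun i => - (s i) / kappa), ths; split => //.
- move=> i z; have -> : - kappa * (- s i / kappa) = s i by field.
  by have [+ _] := Hs i; apply.
- move=> i z zi; have -> : kappa * (- s i / kappa) = - s i by field.
  by have [_ /(_ z zi)] := Hs i; lra.
- by move=> i; rewrite Hths; ring.
Qed.

(** * Energy and its dissipation *)

Section Lyapunov.
Variable R : realType.
Implicit Types k D x y m v l u : R.

(* [x], [y], [m] are the deviations of eta, d, mu from equilibrium, where
   lambda = 0; [l] is lambda, and [v], [u] are the residuals u_2, u_1. *)
Definition node_energy k D x y m v l u : R :=
  k / 2 * x ^+ 2 - k * x * y + y ^+ 2 / 2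
  + (m ^+ 2 + m * v + v ^+ 2 / 2) + (l ^+ 2 + l * u + u ^+ 2 / 2)
  + 3 / 2 * D * l ^+ 2.

(* The time derivative of [node_energy] when [m' = v / 2] and [l' = u / 2]. *)
Definition node_power k D x y m v l u (dx dy dv du : R) : R :=
  k * x * dx - k * (dx * y + x * dy) + y * dy
  + (m * v + v ^+ 2 / 2 + m * dv + v * dv)
  + (l * u + u ^+ 2 / 2 + l * du + u * du)
  + 3 / 2 * D * l * u.

(** Completing squares: [k < 1] lets [y ^+ 2 / 2] absorb the cross term [k * x * y]. *)
Lemma node_energy_ge0 k D x y m v l u :
  0 < k < 1 -> 0 <= D -> 0 <= node_energy k D x y m v l u.
Proof.
move=> /andP[k0 k1] D0.
have -> : node_energy k D x y m v l u =
    k / 2 * (x - y) ^+ 2 + (1 - k) / 2 * y ^+ 2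
    + ((m + v) ^+ 2 / 2 + m ^+ 2 / 2) + ((l + u) ^+ 2 / 2 + l ^+ 2 / 2)
    + 3 / 2 * D * l ^+ 2 by rewrite /node_energy; field.
have H1 : 0 <= k / 2 * (x - y) ^+ 2 by rewrite mulr_ge0 ?sqr_ge0//; lra.
have H2 : 0 <= (1 - k) / 2 * y ^+ 2 by rewrite mulr_ge0 ?sqr_ge0//; lra.
have H3 : 0 <= 3 / 2 * D * l ^+ 2 by rewrite mulr_ge0 ?sqr_ge0//; lra.
have := sqr_ge0 (m + v); have := sqr_ge0 m.
have := sqr_ge0 (l + u); have := sqr_ge0 l; lra.
Qed.

Lemma is_derive_node_energy k D (x y m v l u : R -> R) (t dx dy dv du : R) :
  is_derive t 1 x dx -> is_derive t 1 y dy ->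
  is_derive t 1 m (v t / 2) -> is_derive t 1 v dv ->
  is_derive t 1 l (u t / 2) -> is_derive t 1 u du ->
  is_derive t 1 (fun s => node_energy k D (x s) (y s) (m s) (v s) (l s) (u s))
    (node_power k D (x t) (y t) (m t) (v t) (l t) (u t) dx dy dv du).
Proof.
move=> hx hy hm hv hl hu; rewrite /node_energy /node_power.
by apply: is_derive_eq; rewrite /GRing.scale/=; field.
Qed.

(** Here [a], [b] are the net flow deviations entering [u], [v], and [g] is the deviation of the
    marginal cost. The two product hypotheses express monotonicity of the proximal steps. The weight
    3/2 in the energy cancels the [D * l * u] terms produced by [a] and [da]. *)
Lemma node_dissipation k beta c D x y m v l u (dx dy dv du g a b da db : R) :
  0 < beta -> c = 1 - (1 + k) ^+ 2 / (4 * beta) -> 0 <= D ->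
  u = - y - D * l + a -> v = - y + b ->
  du = - dy - D * (u / 2) + da -> dv = - dy + db ->
  0 <= (- k * x - dx) * (y + dx) ->
  0 <= (- dy - g + k * x + (l + u) + (m + v)) * (y + dy) ->
  beta * y ^+ 2 <= g * y ->
  node_power k D x y m v l u dx dy dv du + g * dy - (m + v) * b - (l + u) * a
  <= - c * (dy ^+ 2 + dx ^+ 2 + (u / 2) ^+ 2 + (v / 2) ^+ 2)
     + (m + v) * db + (l + u) * da.
Proof.
move=> b0 cE D0 uE vE duE dvE Ha Hb Hg.
have -> : a = u + y + D * l by rewrite uE; ring.
have -> : b = v + y by rewrite vE; ring.
have -> : da = du + dy + D * (u / 2) by rewrite duE; ring.
have -> : db = dv + dy by rewrite dvE; ring.
have c1 : 0 <= 1 - c.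
  by rewrite cE opprB addrCA subrr addr0 divr_ge0 ?sqr_ge0// mulr_ge0// ltW.
(* [c] is the value at which [(1 - c) * dx ^+ 2 + (1 + k) * dx * y + beta * y ^+ 2] has zero
   discriminant and is a perfect square. *)
have Q : c * dx ^+ 2 <= dx ^+ 2 + (1 + k) * dx * y + beta * y ^+ 2.
  rewrite -subr_ge0.
  have -> : dx ^+ 2 + (1 + k) * dx * y + beta * y ^+ 2 - c * dx ^+ 2 =
      ((1 + k) * dx + 2 * beta * y) ^+ 2 / (4 * beta).
    by rewrite cE; field; rewrite gt_eqF.
  by rewrite divr_ge0 ?sqr_ge0// mulr_ge0// ltW.
have H1 : 0 <= (1 - c) * dy ^+ 2 by rewrite mulr_ge0 ?sqr_ge0.
have H2 : 0 <= (1 - c) * u ^+ 2 by rewrite mulr_ge0 ?sqr_ge0.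
have H3 : 0 <= (1 - c) * v ^+ 2 by rewrite mulr_ge0 ?sqr_ge0.
have H4 : 0 <= D * l ^+ 2 by rewrite mulr_ge0 ?sqr_ge0.
have H5 : 0 <= D * u ^+ 2 by rewrite mulr_ge0 ?sqr_ge0.
have H6 := sqr_ge0 u; have H7 := sqr_ge0 v.
rewrite /node_power; lra.
Qed.

Lemma network_dissipation (n : nat) (E : {set 'I_n * 'I_n}) (B : 'I_n * 'I_n -> R)
    (k beta c : R) (D x y m v l u dx dy dv du g th dth : 'I_n -> R)
    (p dp : 'I_n * 'I_n -> R) :
  0 < beta -> c = 1 - (1 + k) ^+ 2 / (4 * beta) -> (forall i, 0 <= D i) ->
  (forall i, u i = - y i - D i * l i + netflow E p i) ->
  (forall i, v i = - y i + laplacian E B th i) ->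
  (forall i, du i = - dy i - D i * (u i / 2) + netflow E dp i) ->
  (forall i, dv i = - dy i + laplacian E B dth i) ->
  (forall i, dth i = - laplacian E B (fun j => m j + v j) i) ->
  (forall e, e \in E -> dp e = ediff (fun j => l j + u j) e) ->
  (forall i, 0 <= (- k * x i - dx i) * (y i + dx i)) ->
  (forall i, 0 <= (- dy i - g i + k * x i + (l i + u i) + (m i + v i)) * (y i + dy i)) ->
  (forall i, beta * y i ^+ 2 <= g i * y i) ->
  \sum_i (node_power k (D i) (x i) (y i) (m i) (v i) (l i) (u i)
            (dx i) (dy i) (dv i) (du i) + g i * dy i + th i * dth i)
  + \sum_(e in E) p e * dp e
  <= - c * (\sum_i (dy i ^+ 2 + dx i ^+ 2 + (u i / 2) ^+ 2 + (v i / 2) ^+ 2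
                    + dth i ^+ 2) + \sum_(e in E) dp e ^+ 2).
Proof.
move=> b0 cE D0 uE vE duE dvE dthE dpE Ha Hb Hg.
have sumth (z : 'I_n -> R) :
    \sum_i z i * dth i = - \sum_i (m i + v i) * laplacian E B z i.
  rewrite (laplacian_sym E B (fun j => m j + v j)) -sumrN.
  by apply: eq_bigr => i _; rewrite dthE mulrN.
have sump (q : 'I_n * 'I_n -> R) :
    \sum_(e in E) q e * dp e = - \sum_i (l i + u i) * netflow E q i.
  rewrite sum_mul_netflow opprK.
  by apply: eq_bigr => e eE; rewrite dpE.
have c1 : 0 <= 1 - c.
  by rewrite cE opprB addrCA subrr addr0 divr_ge0 ?sqr_ge0// mulr_ge0// ltW.
have S1 : 0 <= (1 - c) * \sum_i dth i ^+ 2.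
  by apply: mulr_ge0 => //; apply: sumr_ge0 => i _; exact: sqr_ge0.
have S2 : 0 <= (1 - c) * \sum_(e in E) dp e ^+ 2.
  by apply: mulr_ge0 => //; apply: sumr_ge0 => i _; exact: sqr_ge0.
(* Taking [z = dth] here and [q = dp] in [S4] turns the leftover [db] and [da] terms into minus the
   squared angle and flow velocities, with weight 1, which is at least [c]. *)
have S3 : \sum_i dth i ^+ 2 = - \sum_i (m i + v i) * laplacian E B dth i.
  by rewrite -sumth.
have S4 : \sum_(e in E) dp e ^+ 2 = - \sum_i (l i + u i) * netflow E dp i.
  by rewrite -sump.
have S : \sum_i (node_power k (D i) (x i) (y i) (m i) (v i) (l i) (u i)
            (dx i) (dy i) (dv i) (du i) + g i * dy i
            - (m i + v i) * laplacian E B th i - (l i + u i) * netflow E p i) <=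
    \sum_i (- c * (dy i ^+ 2 + dx i ^+ 2 + (u i / 2) ^+ 2 + (v i / 2) ^+ 2)
     + (m i + v i) * laplacian E B dth i + (l i + u i) * netflow E dp i).
  by apply: ler_sum => i _; apply: (@node_dissipation k beta).
rewrite big_split /= sumth sump [X in _ <= - c * (X + _)]big_split /=.
move: S; rewrite !big_split /= -!mulr_sumr !sumrN !big_split /=.
lra.
Qed.

End Lyapunov.

(** * Derivatives of network sums and the decay argument *)

Lemma is_derive_bigsum (R : realType) (I : finType) (Q : pred I)
    (h : I -> R -> R) (dh : I -> R) (t : R) :
  (forall i, is_derive t 1 (h i) (dh i)) ->
  is_derive t 1 (fun s => \sum_(i | Q i) h i s) (\sum_(i | Q i) dh i).
Proof.
move=> H.
have -> : (fun s => \sum_(i | Q i) h i s) = \sum_(i | Q i) h i.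
  by apply/funext => s; rewrite fct_sumE.
elim/big_ind2 : _ => [|f1 d1 f2 d2 h1 h2|i _]; last exact: H.
- exact: is_derive_cst.
- exact: is_deriveD.
Qed.

Lemma is_derive_netflow (R : realType) (n : nat) (E : {set 'I_n * 'I_n})
    (F : R -> 'I_n * 'I_n -> R) (dF : 'I_n * 'I_n -> R) (t : R) (i : 'I_n) :
  (forall e, is_derive t 1 (fun s => F s e) (dF e)) ->
  is_derive t 1 (fun s => netflow E (F s) i) (netflow E dF i).
Proof. by move=> H; apply: is_deriveB; apply: is_derive_bigsum. Qed.

(* If [t * g t > 1] from some time on, then [W + c * ln] is eventually
   nonincreasing, although [W >= 0] and [ln] is unbounded. *)
Lemma dissipation_liminf (R : realType) (c : R) (W dW g : R -> R) :
  0 < c -> (forall t : R, 0 < t -> is_derive t 1 W (dW t)) ->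
  (forall t, 0 < t -> 0 <= W t) -> (forall t, 0 < t -> dW t <= - c * g t) ->
  forall T, exists t, [/\ T <= t, 0 < t & t * g t <= 1].
Proof.
move=> c0 dWE W0 dWle T; apply: contrapT => /forallNP H.
pose a := Num.max T 1.
have a0 : 0 < a by rewrite lt_max ltr01 orbT.
have Hg t : a <= t -> t^-1 <= g t.
  move=> at_; have t0 := lt_le_trans a0 at_.
  rewrite -[leRHS](mulKf (lt0r_neq0 t0)) ler_peMr ?invr_ge0 ?ltW//.
  rewrite ltNge; apply/negP => tg; apply: (H t); split => //.
  by apply: le_trans at_; rewrite le_max lexx.
pose V t := W t + c * ln t.
have dV (t : R) : 0 < t -> is_derive t 1 V (dW t + c * t^-1).
  move=> t0; have h1 := dWE t t0; have h2 := is_derive1_ln t0.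
  by apply: is_derive_eq; rewrite /GRing.scale/=; ring.
have Vdec t : a <= t -> V t <= V a.
  move=> at_; apply: (@ler0_derive1_nincry _ V a) => //.
  - move=> s; rewrite in_itv/= andbT => as_.
    by have [] := dV s (lt_trans a0 as_).
  - move=> s; rewrite in_itv/= andbT => as_; have s0 := lt_trans a0 as_.
    have [_] := dV s s0; rewrite derive1E => ->.
    have := dWle s s0; have := Hg s (ltW as_); nra.
  - apply: derivable_within_continuous => s; rewrite in_itv/= andbT => as_.
    by have [] := dV s (lt_le_trans a0 as_).
(* Chosen so that [a <= t] and [c * ln t >= V a + 1]; since [W t >= 0], this contradicts
   [V t <= V a]. *)
pose t := expR (Num.max (ln a) ((V a + 1) / c)).
have at_ : a <= t.
  rewrite -[leLHS](lnK (_ : a \in Num.pos)) ?posrE// ler_expR.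
  by rewrite le_max lexx.
have := Vdec t at_; rewrite leNgt => /negP; apply.
have lnt : (V a + 1) / c <= ln t by rewrite expRK le_max lexx orbT.
have := W0 t (lt_le_trans a0 at_).
move: lnt; rewrite ler_pdivrMr// [V t]/V; lra.
Qed.

Lemma sqrt_mul_norm_le1 (R : realType) (t a b : R) :
  0 < t -> a <= b -> t * b <= 1 -> Num.sqrt t * Num.sqrt a <= 1.
Proof.
move=> t0 ab tb; rewrite -sqrtrM ?(ltW t0)// -[leRHS]sqrtr1 ler_sqrt//.
by apply: le_trans tb; rewrite ler_pM2l.
Qed.

(** * The decay estimate along a trajectory *)

Theorem theorem3
  (R : realType) (n : nat) (E : {set 'I_n * 'I_n})
  (B : 'I_n * 'I_n -> R) (Dmp : 'I_n -> R) (Pin : 'I_n -> R)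
  (f0 f2 : 'I_n -> R -> R) (dlo dhi : 'I_n -> R)
  (Plo Phi : 'I_n * 'I_n -> R) (beta kappa : R)
  (* network *)
  (HG : graph_connected E)
  (HB : forall e, e \in E -> 0 < B e)
  (HD : forall i, 0 < Dmp i)
  (* costs *)
  (Hf0d : forall i x, derivable (f0 i) x 1)
  (Hf2c : forall i, convex_fun (f2 i))
  (Hf2l : forall i, lower_semicontinuous (fun x => (f2 i x)%:E))
  (* Assumption 1 *)
  (Hbeta : 1 < beta)
  (Hsc : forall i, strongly_convex beta (f0 i))
  (* Assumption 2 (Slater) *)
  (HPlim : forall e, e \in E -> Plo e <= Phi e)
  (Hslater : exists (dt th : 'I_n -> R),
      (forall i, in_relint_interval (dlo i) (dhi i) (dt i)) /\
      (forall i, 0 = Pin i - dt i + netflow E (fun e => B e * ediff th e) i) /\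
      (forall e, e \in E -> Plo e < B e * ediff th e < Phi e))
  (* the constant kappa *)
  (Hkappa : 0 < kappa < 1)
  (* a trajectory of the DPPD dynamics without line limits *)
  (eta d thh lam mu om : R -> 'I_n -> R) (P : R -> 'I_n * 'I_n -> R)
  (Hderiv : forall t, 0 < t ->
     (forall i, derivable (fun s => eta s i) t 1 /\ derivable (fun s => d s i) t 1 /\
                derivable (fun s => thh s i) t 1 /\ derivable (fun s => lam s i) t 1 /\
                derivable (fun s => mu s i) t 1 /\ derivable (fun s => om s i) t 1) /\
     (forall e, derivable (fun s => P s e) t 1))
  (Hdyn : forall t, 0 < t ->
     let u1 i := Pin i - d t i - Dmp i * om t i + netflow E (P t) i in
     let u2 i := Pin i - d t i + netflow E (fun e => B e * ediff (thh t) e) i in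
     (forall i, is_prox_on setT (f2 i) (d t i - kappa * eta t i)
                  (derive1 (fun s => eta s i) t + d t i)) /\
     (forall i, is_prox_on `[dlo i, dhi i] (fun _ => 0)
                  (d t i - derive1 (f0 i) (d t i) + kappa * eta t i + lam t i + u1 i
                     + mu t i + u2 i)
                  (derive1 (fun s => d s i) t + d t i)) /\
     (forall i, om t i = lam t i) /\
     (forall i, derive1 (fun s => thh s i) t =
          \sum_(e in E | e.1 == i) B e * ((mu t i + u2 i) - (mu t e.2 + u2 e.2))
        - \sum_(e in E | e.2 == i) B e * ((mu t e.1 + u2 e.1) - (mu t i + u2 i))) /\
     (forall e, e \in E -> derive1 (fun s => P s e) t =
          (lam t e.1 + u1 e.1) - (lam t e.2 + u1 e.2)) /\
     (forall i, derive1 (fun s => lam s i) t = u1 i / 2) /\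
     (forall i, derive1 (fun s => mu s i) t = u2 i / 2)) :
  (* liminf_{t -> oo} sqrt t * (|d'| + |eta'| + |thh'| + |P'| + |mu'| + |om'|) < oo *)
  exists M : R, forall T : R, exists t : R, T <= t /\ 0 < t /\
    Num.sqrt t *
      (vnorm (fun i => derive1 (fun s => d s i) t)
       + vnorm (fun i => derive1 (fun s => eta s i) t)
       + vnorm (fun i => derive1 (fun s => thh s i) t)
       + enorm E (fun e => derive1 (fun s => P s e) t)
       + vnorm (fun i => derive1 (fun s => mu s i) t)
       + vnorm (fun i => derive1 (fun s => om s i) t)) <= M.
Proof.
have /andP[k0 k1] := Hkappa.
have b0 : 0 < beta by apply: lt_trans Hbeta.
have [dt [tht [Hdt [Htht _]]]] := Hslater.
have Hdt' i : dlo i <= dt i <= dhi i.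
  by case: (Hdt i) => [/andP[h1 h2]|[<- ->]]; rewrite ?(ltW h1) ?(ltW h2)// lexx.
have [c [ds [es [ths [dsi subs nors bals]]]]] :=
  equilibrium_exists HG HB Hf0d Hf2c b0 Hsc (lt0r_neq0 k0) Hdt' Htht.
(* With these line flows, the balance of [u1] at [lam = 0] coincides with that of [u2]. *)
pose Ps e := B e * ediff ths e.
(* [lam] replaces [om], equal to it at positive times, so that differentiating [U1] only brings in
   [lam' = U1 / 2]. *)
pose U1 s i := Pin i - d s i - Dmp i * lam s i + netflow E (P s) i.
pose U2 s i := Pin i - d s i + laplacian E B (thh s) i.
pose Deta t i := derive1 (fun s => eta s i) t.
pose Dd t i := derive1 (fun s => d s i) t.
pose Dth t i := derive1 (fun s => thh s i) t.
pose DP t e := derive1 (fun s => P s e) t.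
pose DU1 t i := - Dd t i - Dmp i * (U1 t i / 2) + netflow E (DP t) i.
pose DU2 t i := - Dd t i + laplacian E B (Dth t) i.
pose G t i := derive1 (f0 i) (d t i) - derive1 (f0 i) (ds i).
pose W t := \sum_i (node_energy kappa (Dmp i) (eta t i - es i) (d t i - ds i)
                      (mu t i - c) (U2 t i) (lam t i) (U1 t i)
                    + (f0 i (d t i) - f0 i (ds i)
                       - derive1 (f0 i) (ds i) * (d t i - ds i))
                    + (thh t i - ths i) ^+ 2 / 2)
            + \sum_(e in E) (P t e - Ps e) ^+ 2 / 2.
pose dW t := \sum_i (node_power kappa (Dmp i) (eta t i - es i) (d t i - ds i)
                      (mu t i - c) (U2 t i) (lam t i) (U1 t i)
                      (Deta t i) (Dd t i) (DU2 t i) (DU1 t i)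
                    + G t i * Dd t i + (thh t i - ths i) * Dth t i)
            + \sum_(e in E) (P t e - Ps e) * DP t e.
pose N t := \sum_i (Dd t i ^+ 2 + Deta t i ^+ 2 + (U1 t i / 2) ^+ 2
                    + (U2 t i / 2) ^+ 2 + Dth t i ^+ 2)
            + \sum_(e in E) DP t e ^+ 2.
pose rate := 1 - (1 + kappa) ^+ 2 / (4 * beta).
have rate0 : 0 < rate.
  (* [(1 + kappa) ^+ 2 < 4 < 4 * beta]. *)
  by rewrite subr_gt0 ltr_pdivrMr ?mulr_gt0// mul1r; nra.
have U1E (t : R) : 0 < t -> forall i,
    Pin i - d t i - Dmp i * om t i + netflow E (P t) i = U1 t i.
  by move=> t0 i; have [_ [_ [-> _]]] := Hdyn t t0.
have W0 (t : R) : 0 < t -> 0 <= W t.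
  move=> t0; apply: addr_ge0; apply: sumr_ge0 => i _; last first.
    by rewrite divr_ge0 ?sqr_ge0.
  apply: addr_ge0; last by rewrite divr_ge0 ?sqr_ge0.
  apply: addr_ge0; first by apply: node_energy_ge0 => //; exact: ltW.
  have := strongly_convex_tangent (d t i) (Hf0d i (ds i)) (Hsc i).
  have : 0 <= beta / 2 * (d t i - ds i) ^+ 2 by rewrite mulr_ge0 ?sqr_ge0//; lra.
  lra.
have dyn1 (t : R) : 0 < t -> forall i, is_derive t 1 (fun s => lam s i) (U1 t i / 2).
  move=> t0 i; have [/(_ i)[_ [_ [_ [dl _]]]] _] := Hderiv t t0.
  have [_ [_ [_ [_ [_ [/(_ i) h _]]]]]] := Hdyn t t0.
  by rewrite -(U1E t t0) -h derive1E; apply/derivableP.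
have dyn2 (t : R) : 0 < t -> forall i, is_derive t 1 (fun s => mu s i) (U2 t i / 2).
  move=> t0 i; have [/(_ i)[_ [_ [_ [_ [dm _]]]]] _] := Hderiv t t0.
  have [_ [_ [_ [_ [_ [_ /(_ i) h]]]]]] := Hdyn t t0.
  by move: h; rewrite derive1E => <-; apply/derivableP.
have dWE (t : R) : 0 < t -> is_derive t 1 W (dW t).
  move=> t0; have [Hd HP] := Hderiv t t0.
  have dP e : is_derive t 1 (fun s => P s e) (DP t e).
    by rewrite /DP derive1E; apply/derivableP.
  have dd i : is_derive t 1 (fun s => d s i) (Dd t i).
    by rewrite /Dd derive1E; apply/derivableP; have [_ []] := Hd i.
  have de i : is_derive t 1 (fun s => eta s i) (Deta t i).
    by rewrite /Deta derive1E; apply/derivableP; have [] := Hd i.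
  have dth i : is_derive t 1 (fun s => thh s i) (Dth t i).
    by rewrite /Dth derive1E; apply/derivableP; have [_ [_ []]] := Hd i.
  have dl i := dyn1 t t0 i; have dm i := dyn2 t t0 i.
  have dU1 i : is_derive t 1 (fun s => U1 s i) (DU1 t i).
    have dn := @is_derive_netflow _ _ E P (DP t) t i dP.
    by apply: is_derive_eq; rewrite /GRing.scale/= /DU1; ring.
  have dU2 i : is_derive t 1 (fun s => U2 s i) (DU2 t i).
    have dn : is_derive t 1 (fun s => laplacian E B (thh s) i) (laplacian E B (Dth t) i).
      by apply: is_derive_netflow.
    by apply: is_derive_eq; rewrite /DU2; ring.
  apply: is_deriveD.
    apply: is_derive_bigsum => i.
    have df : is_derive t 1 (fun s => f0 i (d s i)) (derive1 (f0 i) (d t i) * Dd t i).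
      apply: (@is_derive1_comp _ (f0 i) (fun s => d s i)) => //.
      by rewrite derive1E; apply/derivableP.
    have de' : is_derive t 1 (fun s => eta s i - es i) (Deta t i).
      by apply: is_derive_eq; ring.
    have dd' : is_derive t 1 (fun s => d s i - ds i) (Dd t i).
      by apply: is_derive_eq; ring.
    have dm' : is_derive t 1 (fun s => mu s i - c) (U2 t i / 2).
      by apply: is_derive_eq; ring.
    have dn := is_derive_node_energy kappa (Dmp i) de' dd' dm' (dU2 i) (dl i) (dU1 i).
    by apply: is_derive_eq; rewrite /GRing.scale/= /G; field.
  apply: is_derive_bigsum => e.
  by apply: is_derive_eq; rewrite /GRing.scale/=; field.
have dWle (t : R) : 0 < t -> dW t <= - rate * N t.
  move=> t0; have [pr2 [pr1 [_ [eqth [eqP _]]]]] := Hdyn t t0.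
  apply: (@network_dissipation _ _ E B kappa beta) => //.
  - by move=> i; exact: ltW.
  - move=> i; rewrite netflowB /U1 /Ps.
    by have := bals i; rewrite /laplacian; lra.
  - by move=> i; rewrite laplacianB /U2; have := bals i; lra.
  - move=> i; rewrite /Dth eqth laplacianE opprB.
    by congr (_ - _); apply: eq_bigr => e _; rewrite /U2 /laplacian; ring.
  - by move=> e eE; rewrite /DP eqP// !U1E.
  (* The proximal inequality tested at [ds i] is added to the equilibrium inequality tested at the
     proximal point; the next case does the same for the interval. *)
  - move=> i.
    have := @is_prox_on_subgradient _ _ _ _ _ (ds i) (Hf2c i) (pr2 i) (fun _ _ => I).
    have := subs i (Deta t i + d t i); rewrite /Deta; nra.
  - move=> i; have pi := pr1 i; rewrite U1E// in pi.
    have := is_prox_on_itv_normal pi (dsi i).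
    have := nors i (Dd t i + d t i).
    case: pi => /=; rewrite in_itv/= => -> _ /(_ isT).
    rewrite /G /U2 /laplacian /Dd; nra.
  - by move=> i; exact: strongly_monotone_derive1.
(* One unit for each of the six norms, whose squares are all bounded by [N t]. *)
exists 6 => T.
have [t [Tt t0 tN]] := dissipation_liminf rate0 dWE W0 dWle T.
exists t; split=> //; split=> //.
have nonneg i : [/\ 0 <= Dd t i ^+ 2, 0 <= Deta t i ^+ 2, 0 <= (U1 t i / 2) ^+ 2,
    0 <= (U2 t i / 2) ^+ 2 & 0 <= Dth t i ^+ 2] by split; exact: sqr_ge0.
have bound (q : 'I_n -> R) : (forall i, q i ^+ 2 <= Dd t i ^+ 2 + Deta t i ^+ 2
      + (U1 t i / 2) ^+ 2 + (U2 t i / 2) ^+ 2 + Dth t i ^+ 2) ->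
    Num.sqrt t * vnorm q <= 1.
  move=> hq; apply: (sqrt_mul_norm_le1 t0 _ tN).
  rewrite -[leLHS]addr0; apply: lerD; first exact: ler_sum.
  by apply: sumr_ge0 => e _; exact: sqr_ge0.
have B1 : Num.sqrt t * vnorm (Dd t) <= 1.
  by apply: bound => i; have [] := nonneg i; lra.
have B2 : Num.sqrt t * vnorm (Deta t) <= 1.
  by apply: bound => i; have [] := nonneg i; lra.
have B3 : Num.sqrt t * vnorm (Dth t) <= 1.
  by apply: bound => i; have [] := nonneg i; lra.
have B4 : Num.sqrt t * enorm E (DP t) <= 1.
  apply: (sqrt_mul_norm_le1 t0 _ tN).
  rewrite -[leLHS]add0r; apply: lerD => //.
  by apply: sumr_ge0 => i _; have [] := nonneg i; lra.
have B5 : Num.sqrt t * vnorm (fun i => derive1 (fun s => mu s i) t) <= 1.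
  apply: bound => i; have [_] := dyn2 t t0 i; rewrite derive1E => ->.
  by have [] := nonneg i; lra.
have B6 : Num.sqrt t * vnorm (fun i => derive1 (fun s => om s i) t) <= 1.
  apply: bound => i.
  (* [om] and [lam] agree only at positive times, hence near [t], which suffices to transfer the
     derivative. *)
  have [|_] := near_eq_is_derive (g := fun s => om s i) _ (dyn1 t t0 i).
    near=> s; have s0 : 0 < s by near: s; exact: lt_nbhsr.
    by have [_ [_ [-> _]]] := Hdyn s s0.
  by rewrite derive1E => ->; have [] := nonneg i; lra.
move: B1 B2 B3 B4 B5 B6; rewrite !mulrDr; lra.
Unshelve. all: by end_near.
Qed.
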